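(* Let $p$ be a prime and let $X$ be any (connected, pointed) space with $\pi_1(X,* )\cong C_p$, the cyclic group of order $p$. Let $T$ be a generator of $H^1(X;\mathbb{F}_p)\cong\mathbb{F}_p$. Then $T$ has vanishing cup and Massey powers up to order $p-1$, i.e. $\langle\underbrace{T,\dots,T}_{k}\rangle=0$ for $2\le k\le p-1$, but its $p$-th Massey power is nonzero: $$\langle\underbrace{T,\dots,T}_{p\text{ times}}\rangle\neq0\in H^2(X;\mathbb{F}_p).$$
   Context: Massey products are taken in the cohomology of the (associative) cochain algebra of $X$ with $\mathbb{F}_p$ coefficients, in the usual sense of defining systems; the $2$-fold Massey power is, up to sign, the cup square $T\smile T$. ''Vanishes'' means that the product is defined and contains $0$; ''nonzero'' means that it is defined and does not contain $0$. *)

(* Defs.v *)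
From HB Require Import structures.
From mathcomp Require Import all_boot all_order all_algebra.
From mathcomp Require Import generic_quotient ring_quotient.
From mathcomp Require Import all_classical all_reals all_analysis.
From mathcomp Require Import homotopy.

Set Implicit Arguments.
Unset Strict Implicit.
Unset Printing Implicit Defensive.

Import Order.TTheory GRing.Theory Num.Theory.
Import numFieldNormedType.Exports.

Local Open Scope classical_set_scope.
Local Open Scope ring_scope.
Local Open Scope quotient_scope.

Section UnitInterval.
Variable R : realType.

Definition unitI : Type := set_type `[0%R, 1%R : R]%classic.

HB.instance Definition _ := Topological.on unitI.

Definition ival (s : unitI) : R := set_val s.

Lemma clamp_proof (t : R) :
  Num.max 0 (Num.min t 1) \in `[0%R, 1%R : R]%classic.
Proof.
rewrite inE /= in_itv /= le_max lexx /=.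
by rewrite ge_max ler01 ge_min lexx orbT.
Qed.

Definition clampI (t : R) : unitI :=
  exist (fun u => u \in `[0%R, 1%R : R]%classic) _ (clamp_proof t).

Lemma ival_clampI t : 0 <= t <= 1 -> ival (clampI t) = t.
Proof. by move=> /andP[t0 t1]; rewrite /ival set_valE /= min_l // max_r. Qed.

Lemma ival_itv (s : unitI) : 0 <= ival s <= 1.
Proof. by have /set_mem := valP s; rewrite /= in_itv. Qed.

Lemma clampIK (s : unitI) : clampI (ival s) = s.
Proof. by apply: val_inj; exact: ival_clampI (ival_itv s). Qed.

Lemma clampI_continuous : continuous clampI.
Proof.
apply: continuous_comp_initial => t.
apply: (@continuous_max _ R (cst 0) (fun t => Num.min t 1)).
  exact: cvg_cst.
apply: (@continuous_min _ R id (cst 1)).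
  exact: cvg_id.
exact: cvg_cst.
Qed.

Lemma clampI_neq : clampI 0 != clampI 1.
Proof.
apply/eqP => /(congr1 ival); rewrite !ival_clampI ?lexx ?ler01 // => /eqP.
by rewrite eq_sym oner_eq0.
Qed.

HB.instance Definition _ := isBiPointed.Build unitI clampI_neq.

End UnitInterval.

Arguments ival : simpl never.

Lemma continuous_glue (R : realType) (T U : topologicalType) (c : R)
    (h : T -> R) (f g : T -> U) :
  continuous h -> continuous f -> continuous g ->
  (forall t, h t = c -> f t = g t) ->
  continuous (fun t => if h t <= c then f t else g t).
Proof.
move=> ch cf cg fg; apply/continuous_subspace_setT.
have -> : [set: T] = h @^-1` [set x | x <= c] `|` h @^-1` [set x | c <= x].
  by apply/seteqP; split=> t //= _; apply/orP; exact: le_total.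
apply: withinU_continuous.
- by apply: preimage_closed => [t _|]; [exact: ch|exact: closed_le].
- by apply: preimage_closed => [t _|]; [exact: ch|exact: closed_ge].
- apply: (@subspace_eq_continuous _ _ _ f); last exact: continuous_subspaceT.
  by move=> t; rewrite inE /from_subspace /= => ->.
- apply: (@subspace_eq_continuous _ _ _ g); last exact: continuous_subspaceT.
  move=> t; rewrite inE /from_subspace /= => ct.
  by case: ifPn => // tc; rewrite fg //; apply/eqP; rewrite eq_le tc.
Qed.

Local Lemma ccomp (S T U : topologicalType) (f : S -> T) (g : T -> U) :
  continuous f -> continuous g -> continuous (fun x => g (f x)).
Proof. by move=> cf cg x; exact: continuous_comp (cf x) (cg _). Qed.

Local Lemma cpair (S T U : topologicalType) (f : S -> T) (g : S -> U) :
  continuous f -> continuous g -> continuous (fun x => (f x, g x)).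
Proof. by move=> cf cg x; apply: cvg_pair; [exact: cf|exact: cg]. Qed.

Local Lemma cfst (S T : topologicalType) : continuous (@fst S T).
Proof. by move=> z; exact: cvg_fst. Qed.

Local Lemma csnd (S T : topologicalType) : continuous (@snd S T).
Proof. by move=> z; exact: cvg_snd. Qed.

Local Lemma cval (R : realType) : continuous (@ival R).
Proof. exact: initial_continuous. Qed.

Local Lemma caff (R : realType) (a b : R) :
  continuous (fun t : R => a * t + b).
Proof.
move=> t; apply: cvgD; last exact: cvg_cst.
by apply: cvgM; [exact: cvg_cst|exact: cvg_id].
Qed.

Local Lemma cclamp (R : realType) (S : topologicalType) (h : S -> R) (a b : R) :
  continuous h -> continuous (fun z => clampI (a * h z + b)).
Proof.
by move=> ch; apply: ccomp (@clampI_continuous R); exact: ccomp ch (@caff R a b).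
Qed.

Local Lemma ival_zero (R : realType) : ival (zero : unitI R) = 0.
Proof. by rewrite ival_clampI // lexx ler01. Qed.

Local Lemma ival_one (R : realType) : ival (one : unitI R) = 1.
Proof. by rewrite ival_clampI // lexx ler01. Qed.

Section FundamentalGroup.
Variables (R : realType) (X : topologicalType) (x0 : X).

Notation I := (unitI R).

Definition loop := {path I from x0 to x0 in X}.

HB.instance Definition _ := Choice.on loop.

Implicit Types (a b c : loop).

Definition loop_homotopy a b (H : I * I -> X) :=
  [/\ continuous H,
      forall t, H (t, zero) = a t, forall t, H (t, one) = b t &
      forall s, H (zero, s) = x0 /\ H (one, s) = x0].

Definition loop_homotopic a b := `[< exists H, loop_homotopy a b H >].

Lemma loop_homotopic_refl : reflexive loop_homotopic.
Proof.
move=> a; apply/asboolP; exists (fun z => a z.1); split=> //=.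
  by apply: (ccomp (@cfst _ _)); exact: cts_fun.
by move=> s; rewrite path_zero path_one.
Qed.

Lemma loop_homotopic_sym : symmetric loop_homotopic.
Proof.
suff sub a b : loop_homotopic a b -> loop_homotopic b a.
  by move=> a b; apply/idP/idP; exact: sub.
move=> /asboolP[H [cH H0 H1 Hx]]; apply/asboolP.
exists (fun z => H (z.1, clampI (-1 * ival z.2 + 1))); split=> [|t|t|s] //=.
- apply: (ccomp _ cH); apply: cpair; first exact: cfst.
  by apply: cclamp; exact: ccomp (@csnd _ _) (@cval R).
- by rewrite ival_zero mulr0 add0r -H1.
- by rewrite ival_one mulr1 addNr -H0.
Qed.

Lemma loop_homotopic_trans : transitive loop_homotopic.
Proof.
move=> b a c /asboolP[H [cH H0 H1 Hx]] /asboolP[K [cK K0 K1 Kx]].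
apply/asboolP.
have cv : continuous (fun z : I * I => ival z.2).
  exact: ccomp (@csnd _ _) (@cval R).
exists (fun z => if ival z.2 <= 2^-1 then H (z.1, clampI (2 * ival z.2 + 0))
                 else K (z.1, clampI (2 * ival z.2 + -1))).
split=> [|t|t|s] /=.
- apply: continuous_glue => //.
  + apply: (ccomp _ cH); apply: cpair; first exact: cfst.
    exact: cclamp.
  + apply: (ccomp _ cK); apply: cpair; first exact: cfst.
    exact: cclamp.
  + by move=> z ->; rewrite mulfV ?pnatr_eq0 // addr0 subrr H1 K0.
- by rewrite ival_zero invr_ge0 ler0n mulr0 addr0 H0.
- rewrite ival_one lt_geF ?invf_lt1 ?ltr1n ?ltr0n // mulr1.
  by rewrite -[X in X - 1]/(1 + 1) addrK K1.
- by case: ifP => _; [exact: Hx|exact: Kx].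
Qed.

Definition loop_homotopic_equiv := EquivRel loop_homotopic
  loop_homotopic_refl loop_homotopic_sym loop_homotopic_trans.

Definition pi1 := {eq_quot loop_homotopic_equiv}.

HB.instance Definition _ := Choice.on pi1.
HB.instance Definition _ := EqQuotient.on pi1.

Definition concat_fun a b (t : I) : X :=
  if ival t <= 2^-1 then a (clampI (2 * ival t))
  else b (clampI (2 * ival t - 1)).

Lemma concat_continuous a b : continuous (concat_fun a b).
Proof.
have ca : continuous (a : I -> X) by exact: cts_fun.
have cb : continuous (b : I -> X) by exact: cts_fun.
apply: continuous_glue => [|||t ->]; first exact: cval.
- have c2 : continuous (fun u : I => clampI (2 * ival u)).
    have -> : (fun u : I => clampI (2 * ival u)) =
              (fun u => clampI (2 * ival u + 0)) by apply/funext => u; rewrite addr0.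
    exact: cclamp (@cval R).
  exact: (ccomp c2 ca).
- exact: (ccomp (@cclamp R _ _ 2 (-1) (@cval R)) cb).
- by rewrite mulfV ?pnatr_eq0 // subrr [LHS]path_one [RHS]path_zero.
Qed.

Lemma concat_zero a b : concat_fun a b zero = x0.
Proof.
by rewrite /concat_fun ival_zero invr_ge0 ler0n mulr0 [LHS]path_zero.
Qed.

Lemma concat_one a b : concat_fun a b one = x0.
Proof.
rewrite /concat_fun ival_one lt_geF ?invf_lt1 ?ltr1n ?ltr0n // mulr1.
by rewrite -[X in X - 1]/(1 + 1) addrK [LHS]path_one.
Qed.

Definition concat a b : loop :=
  mk_path (@concat_continuous a b) (concat_zero a b) (concat_one a b).

Definition pi1_mul : pi1 -> pi1 -> pi1 := lift_op2 pi1 concat.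

Lemma pi1_mul_pi : {morph \pi_pi1 : a b / concat a b >-> pi1_mul a b}.
Proof.
move=> a b; unlock pi1_mul; apply/eqmodP/asboolP => /=.
have /eqmodP/asboolP[H [cH H0 H1 Hx]] : a = repr (\pi_pi1 a) %[mod pi1].
  by rewrite reprK.
have /eqmodP/asboolP[K [cK K0 K1 Kx]] : b = repr (\pi_pi1 b) %[mod pi1].
  by rewrite reprK.
have cv : continuous (fun z : I * I => ival z.1).
  exact: ccomp (@cfst _ _) (@cval R).
exists (fun z => if ival z.1 <= 2^-1 then H (clampI (2 * ival z.1 + 0), z.2)
                 else K (clampI (2 * ival z.1 + -1), z.2)).
split=> [|t|t|s] /=.
- apply: continuous_glue => //.
  + apply: (ccomp _ cH); apply: cpair; last exact: csnd.
    exact: cclamp.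
  + apply: (ccomp _ cK); apply: cpair; last exact: csnd.
    exact: cclamp.
  + move=> z ->; rewrite mulfV ?pnatr_eq0 // addr0 subrr.
    by rewrite (Hx z.2).2 (Kx z.2).1.
- by rewrite addr0 H0 K0.
- by rewrite addr0 H1 K1.
- rewrite ival_zero ival_one invr_ge0 ler0n mulr0 addr0 (Hx s).1.
  rewrite lt_geF ?invf_lt1 ?ltr1n ?ltr0n // mulr1.
  by rewrite -[X in X - 1]/(1 + 1) addrK (Kx s).2.
Qed.

End FundamentalGroup.

Arguments loop : clear implicits.
Arguments pi1 : clear implicits.

Section StandardSimplex.
Variable R : realType.

Definition stdsimplex n : set 'rV[R]_n.+1 :=
  [set x | (forall i, 0 <= x 0 i) /\ \sum_i x 0 i = 1].

Arguments stdsimplex : clear implicits.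

Definition stdsimplexT n : Type := set_type (stdsimplex n).

HB.instance Definition _ n := Topological.on (stdsimplexT n).

Variables (m n : nat) (f : 'I_m.+1 -> 'I_n.+1).

(* In barycentric coordinates, the affine map sending vertex i to vertex f i. *)
Definition push_fun (x : 'rV[R]_m.+1) : 'rV[R]_n.+1 :=
  \row_j \sum_(i | f i == j) x 0 i.

Lemma push_proof (x : stdsimplexT m) : push_fun (set_val x) \in stdsimplex n.
Proof.
have /set_mem[x_ge0 x_sum] := valP x; apply/mem_set; split=> [j|].
  by rewrite mxE; apply: sumr_ge0 => i _; exact: x_ge0.
rewrite -[RHS]x_sum [RHS](partition_big f xpredT) //=.
by apply: eq_bigr => j _; rewrite mxE.
Qed.

Definition push (x : stdsimplexT m) : stdsimplexT n :=
  exist (fun y => y \in stdsimplex n) _ (push_proof x).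

Lemma push_continuous : continuous push.
Proof.
apply: continuous_comp_initial.
have cpush : continuous push_fun.
  move=> x U [P nP PU]; rewrite nbhs_simpl /=.
  apply: (filterS (fun y => PU (push_fun y))).
  suff nQ i j : nbhs x [set y | P i j (push_fun y i j)].
    have h i : nbhs x [set y | forall j, P i j (push_fun y i j)].
      exact: (@filter_forall _ _ (fun j => [set y | P i j (push_fun y i j)]) (nbhs x) _ (nQ i)).
    exact: (@filter_forall _ _
      (fun i => [set y | forall j, P i j (push_fun y i j)]) (nbhs x) _ h).
  have cj : continuous (fun y => push_fun y i j).
    under eq_fun do rewrite mxE.
    apply: continuous_big => //; first exact: add_continuous.
    by move=> k _; exact: coord_continuous.
  exact: cj (nP i j).
exact: (ccomp (@initial_continuous _ _ (set_val : stdsimplexT m -> _)) cpush).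
Qed.

HB.instance Definition _ := isContinuous.Build _ _ push push_continuous.

End StandardSimplex.

Section Cochains.
Variables (R : realType) (X : topologicalType) (A : nzRingType).

Definition simplex n := continuousType (stdsimplexT R n) X.

Definition restr m n (f : 'I_m.+1 -> 'I_n.+1) (s : simplex n) : simplex m :=
  s \o push f.

Definition face n (i : 'I_n.+2) : simplex n.+1 -> simplex n := restr (lift i).

Definition cochain n : Type := simplex n -> A.

HB.instance Definition _ n := GRing.Zmodule.on (cochain n).

Definition cobound n (c : cochain n) : cochain n.+1 :=
  fun s => \sum_(i < n.+2) (-1) ^+ i * c (face i s).

Lemma coboundB n : {morph @cobound n : c d / c - d}.
Proof.
move=> c d; apply/funext => s; rewrite /cobound /=.
rewrite [RHS]/GRing.add /= /GRing.opp /= -sumrB.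
by apply: eq_bigr => i _; rewrite -mulrBr.
Qed.

Definition cup m n (c : cochain m) (d : cochain n) : cochain (m + n) :=
  fun s => c (restr (fun i : 'I_m.+1 => inord i) s)
         * d (restr (fun i : 'I_n.+1 => inord (m + i)) s).

Definition cocycle_pred n : {pred cochain n} := [pred c | cobound c == 0].

Lemma cocycle_closed n : zmod_closed (@cocycle_pred n).
Proof.
split=> [|c d].
  by rewrite inE -[X in cobound X](subrr 0) coboundB subrr.
by rewrite !inE coboundB => -> ->; rewrite subrr.
Qed.

HB.instance Definition _ n :=
  GRing.isZmodClosed.Build (cochain n) (@cocycle_pred n) (@cocycle_closed n).

Record cocycle n := Cocycle {
  cocycle_val :> cochain n;
  _ : cocycle_val \in @cocycle_pred n
}.

HB.instance Definition _ n := [isSub for @cocycle_val n].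
HB.instance Definition _ n := [Choice of cocycle n by <:].
HB.instance Definition _ n := [SubChoice_isSubZmodule of cocycle n by <:].

Definition is_coboundary n : cochain n -> Prop :=
  if n is m.+1 then fun c => exists b : cochain m, c = cobound b
  else fun c => c = 0.

Definition coboundary_pred n : {pred cocycle n} :=
  [pred z | `[< is_coboundary (cocycle_val z) >]].

Lemma coboundary_closed n : zmod_closed (@coboundary_pred n).
Proof.
split=> [|z w]; rewrite !inE.
  case: n => [//|n] /=; exists 0.
  by rewrite -[X in cobound X](subrr 0) coboundB subrr.
case: n z w => [|n] z w /=.
  by move=> z0 w0; rewrite z0 w0 subrr.
move=> [b zb] [c wc]; exists (b - c).
by rewrite zb wc coboundB.
Qed.

HB.instance Definition _ n :=
  GRing.isZmodClosed.Build (cocycle n) (@coboundary_pred n)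
    (@coboundary_closed n).

Definition cohomology n : Type := Quotient.quot (@coboundary_pred n).

HB.instance Definition _ n := GRing.Zmodule.on (cohomology n).
HB.instance Definition _ n := EqQuotient.on (cohomology n).

End Cochains.

Arguments simplex : clear implicits.
Arguments cochain : clear implicits.
Arguments cocycle : clear implicits.
Arguments cohomology : clear implicits.


Section Massey.
Variables (R : realType) (X : topologicalType) (A : nzRingType).

Notation C n := (cochain R X A n).
Notation H n := (cohomology R X A n).

Definition represents n (c : C n) (h : H n) : Prop :=
  exists2 z : cocycle R X A n, cocycle_val z = c & \pi_(H n) z = h.

(* Defining systems for the Massey product of degree-one classes
   Ts = [:: T_0; ..; T_(k-1)], with entries a i j for 0 <= i <= j < k and
   (i, j) <> (0, k-1); the other values of a are irrelevant.
   In the general formula each first factor carries the sign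
   (-1)^(1 + degree), which is trivial here since all a i j have degree 1. *)
Definition defining_system (Ts : seq (H 1)) (a : nat -> nat -> C 1) : Prop :=
  (forall i, (i < size Ts)%N -> represents (a i i) Ts`_i) /\
  (forall i j, (i < j < size Ts)%N -> (i, j) != (0%N, (size Ts).-1) ->
     cobound (a i j) = \sum_(i <= r < j) cup (a i r) (a r.+1 j)).

Definition massey (Ts : seq (H 1)) : set (H 2) :=
  [set w | exists2 a, defining_system Ts a &
     represents (\sum_(0 <= r < (size Ts).-1) cup (a 0%N r) (a r.+1 (size Ts).-1))
       w].

Definition massey_defined (Ts : seq (H 1)) : Prop :=
  exists a, defining_system Ts a.

(* Massey products are sets of classes, with indeterminacy: vanishing means
   containing 0. *)
Definition massey_vanishes (Ts : seq (H 1)) : Prop :=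
  massey_defined Ts /\ massey Ts 0.

Definition massey_nonzero (Ts : seq (H 1)) : Prop :=
  massey_defined Ts /\ ~ massey Ts 0.

End Massey.

(* Main.v *)
(** On the [k]-fold product with [k < p], the divided powers [t^m / m!] of a
    cocycle [t] representing [T] form a defining system up to sign, and the next
    divided power [t^k / k!] cobounds the product.

    For [k = p], a cochain cobounding the product completes the defining system
    to a strictly upper triangular matrix [N] of 1-cochains with [1 - N]
    multiplicative on 2-simplices, hence to a representation of the fundamental
    group by unitriangular matrices of size [p + 1] over [F_p].  On a generator
    [l] every superdiagonal entry of [N] is [T l], and [(1 - N)^p = 1 - N^p]
    must be 1; as the corner entry of [N^p] is [(T l)^p], this gives [T l = 0].
    But some class in [H^1] does not vanish on [l]: transport the isomorphism
    from the fundamental group to edges by means of chosen paths from the base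
    point.  Only the path component of the base point matters, points outside
    being sent to 0. *)
Require Import Defs.
From mathcomp Require Import all_boot all_order all_algebra.
From mathcomp Require Import zify ring lra generic_quotient ring_quotient.
From mathcomp Require Import all_classical all_reals all_analysis.
From mathcomp Require Import homotopy.

Set Implicit Arguments.
Unset Strict Implicit.
Unset Printing Implicit Defensive.

Import Order.TTheory GRing.Theory Num.Theory.
Import numFieldNormedType.Exports.

Local Open Scope classical_set_scope.
Local Open Scope ring_scope.
Local Open Scope quotient_scope.

(** * Cochains in degree one *)

Lemma ord2_neq0 (i : 'I_2) : i != ord0 -> i = ord_max.
Proof. by move=> i0; apply: val_inj; case: i i0 => -[|[|]]. Qed.

Section EdgeFormulas.
Variables (R : realType) (X : topologicalType).

Lemma simplexP n (s t : simplex R X n) : (forall x, s x = t x) -> s = t.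
Proof. by move=> st; apply/continuousEP. Qed.

Lemma push_comp l m n (f : 'I_m.+1 -> 'I_n.+1) (g : 'I_l.+1 -> 'I_m.+1)
    (x : stdsimplexT R l) : push f (push g x) = push (fun i => f (g i)) x.
Proof.
apply: val_inj; apply/rowP => k; rewrite /= !mxE.
rewrite (partition_big g (fun i => f i == k)) //=.
apply: eq_bigr => i /eqP fi; rewrite mxE; apply: eq_bigl => j.
by case: eqP => [->|]; rewrite ?fi ?eqxx ?andbF.
Qed.

Lemma restr_comp l m n (f : 'I_m.+1 -> 'I_n.+1) (g : 'I_l.+1 -> 'I_m.+1)
    (s : simplex R X n) : restr g (restr f s) = restr (fun i => f (g i)) s.
Proof. by apply: simplexP => x; rewrite /= push_comp. Qed.

Definition edge n (s : simplex R X n) (u v : 'I_n.+1) : simplex R X 1 :=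
  restr (fun k : 'I_2 => if k == ord0 then u else v) s.

Lemma restr_edge n (f : 'I_2 -> 'I_n.+1) (s : simplex R X n) u v :
  f ord0 = u -> f ord_max = v -> restr f s = edge s u v.
Proof.
move=> f0 f1; congr (restr _ s); apply/funext => k.
by have [->//|/ord2_neq0 ->] := eqVneq k ord0.
Qed.

Lemma edge_restr m n (f : 'I_m.+1 -> 'I_n.+1) (s : simplex R X n) u v :
  edge (restr f s) u v = edge s (f u) (f v).
Proof. by rewrite /edge restr_comp; apply: restr_edge. Qed.

Variable A : nzRingType.
Notation C n := (cochain R X A n).

Lemma cochain_sumE n I (r : seq I) (P : pred I) (F : I -> C n) s :
  (\sum_(i <- r | P i) F i) s = \sum_(i <- r | P i) F i s.
Proof. by elim/big_rec2: _ => // i c x _ <-. Qed.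

Definition v0 : 'I_3 := @Ordinal 3 0 isT.
Definition v1 : 'I_3 := @Ordinal 3 1 isT.
Definition v2 : 'I_3 := @Ordinal 3 2 isT.

Lemma cobound1E (c : C 1) s :
  cobound c s = c (edge s v1 v2) - c (edge s v0 v2) + c (edge s v0 v1).
Proof.
have eE (i u v : 'I_3) : lift i ord0 = u -> lift i ord_max = v ->
    c (face i s) = c (edge s u v).
  by move=> iu iv; congr c; exact: restr_edge.
rewrite /cobound !big_ord_recl big_ord0 (eE _ v1 v2) 1?(eE _ v0 v2) 1?(eE _ v0 v1);
  try exact: val_inj.
by rewrite expr0 expr1 sqrrN expr1n !mul1r mulN1r addr0 addrA.
Qed.

Lemma cup11E (c d : C 1) s :
  cup c d s = c (edge s v0 v1) * d (edge s v1 v2).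
Proof.
rewrite /cup; congr (c _ * d _);
  by apply: restr_edge; apply: val_inj; rewrite /= inordK.
Qed.

Lemma cobound0E (c : C 0) s :
  cobound c s = c (restr (fun=> ord_max) s) - c (restr (fun=> ord0) s).
Proof.
have eE (i u : 'I_2) : lift i ord0 = u -> c (face i s) = c (restr (fun=> u) s).
  move=> iu; congr c; congr (restr _ s); apply/funext => k.
  by rewrite (ord1 k).
rewrite /cobound !big_ord_recl big_ord0 (eE _ ord_max) 1?(eE _ ord0);
  try by apply: val_inj.
by rewrite expr0 expr1 mul1r mulN1r addr0.
Qed.

End EdgeFormulas.

Lemma cobound_cobound1 (R : realType) (X : topologicalType) (A : comNzRingType)
    (c : cochain R X A 1) : cobound (cobound c) = 0.
Proof.
apply/funext => s; rewrite [LHS]/cobound.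
under eq_bigr do rewrite cobound1E !edge_restr.
rewrite !big_ord_recl big_ord0 /=.
(* Indexing the edges of the 3-simplex by [nat] turns the twelve edge terms into values of [e],
   which then cancel in pairs by [ring]. *)
pose e (u v : nat) := c (edge s (inord u) (inord v)).
have eE (i : 'I_4) (u v : 'I_3) : c (edge s (lift i u) (lift i v)) = e (bump i u) (bump i v).
  by rewrite /e; congr (c (edge s _ _)); apply: val_inj; rewrite /= inordK // (valP (lift i _)).
rewrite !eE /bump /=.
rewrite -[RHS]/(0 : A); by ring.
Qed.

(** * Divided powers *)

Section DividedPowers.
Variable K : fieldType.

Definition divpow m (z : K) := z ^+ m / m`!%:R.

Lemma divpow0 z : divpow 0 z = 1.
Proof. by rewrite /divpow expr0 fact0 divr1. Qed.

(** The binomial theorem divided by [m!]. As [r!] and [(m - r)!] divide [m!], every denominator is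
    invertible once [m!] is. *)
Lemma divpowD m (x y : K) : m`!%:R != 0 :> K ->
  divpow m (x + y) = \sum_(r < m.+1) divpow r x * divpow (m - r) y.
Proof.
move=> m0; rewrite /divpow addrC exprDn mulr_suml; apply: eq_bigr => r _.
have rm : (r <= m)%N by rewrite -ltnS.
have /(congr1 (fun n : nat => n%:R : K)) := bin_fact rm.
rewrite !natrM => E.
have := m0; rewrite -E !mulf_eq0 !negb_or => /and3P[b0 r0 mr0].
by rewrite -mulr_natr; field; rewrite mr0 r0.
Qed.

Variables (R : realType) (X : topologicalType).
Notation C n := (cochain R X K n).

(* The sign makes the defining-system equations hold with the sign
   conventions of [cobound] and [cup]. *)
Definition dpcochain (t : C 1) m : C 1 :=
  fun s => (-1) ^+ m.-1 * divpow m (t s).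

Lemma cocycle1D (t : C 1) s : cobound t = 0 ->
  t (edge s v0 v2) = t (edge s v0 v1) + t (edge s v1 v2).
Proof.
move=> /(congr1 (fun c : C 2 => c s)); rewrite cobound1E -[RHS]/(0 : K) => E.
by apply/eqP; rewrite -subr_eq0 -oppr_eq0 -E; apply/eqP; ring.
Qed.

(** A cocycle is additive along a triangle, so expanding [t^m / m!] on the long edge leaves minus
    the mixed terms of [divpowD]. Only [m = j + 1 - i] matters. *)
Lemma cobound_dpcochain (t : C 1) i j : cobound t = 0 -> (i <= j)%N ->
  (j.+1 - i)`!%:R != 0 :> K ->
  cobound (dpcochain t (j.+1 - i)) =
  \sum_(i <= r < j) cup (dpcochain t (r.+1 - i)) (dpcochain t (j.+1 - r.+1)).
Proof.
move=> dt ij; rewrite -(subnK ij); set d := (j - i)%N; rewrite -addSn addnK => d0.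
apply/funext => s; rewrite cobound1E cochain_sumE /dpcochain.
rewrite (cocycle1D s dt) divpowD //.
rewrite -{1}[i]add0n big_addn addnK big_mkord big_ord_recl big_ord_recr /= subnn subn0.
rewrite !divpow0 /bump leq0n add1n; set S := \sum_(_ < _) _.
(* The two extreme terms of the expansion cancel against the short edges. Each mixed product carries
   the sign [(-1)^(d - 1)], which absorbs the remaining minus. *)
transitivity (- ((-1) ^+ d * S)); first by move: (S) => S'; ring.
rewrite -mulN1r mulrA -exprS mulr_sumr; apply: eq_bigr => r _; rewrite cup11E.
have rd := ltn_ord r.
have -> : ((r + i).+1 - i = r.+1)%N by lia.
have -> : ((d + i).+1 - (r + i).+1 = d - r)%N by lia.
rewrite leq0n -[(true + r)%N]/r.+1 subSS /=.
rewrite [RHS]mulrACA -exprD; congr (_ * _).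
have -> : d.+1 = (r + (d - r).-1).+2 by lia.
by rewrite !exprS !mulN1r opprK.
Qed.

End DividedPowers.

(** * Cohomology classes and their representing cocycles *)

Section Classes.
Variables (R : realType) (X : topologicalType) (A : comNzRingType).
Notation C n := (cochain R X A n).
Notation H n := (cohomology R X A n).

Lemma class_eq0 n (z : cocycle R X A n) :
  (\pi_(H n) z == 0) = `[< is_coboundary (cocycle_val z) >].
Proof.
have <- : \pi_(H n) (0 : cocycle R X A n) = 0 by rewrite raddf0.
rewrite (@eqquotE _ _ (Quotient.quot (@coboundary_pred R X A n))) Quotient.equivE.
by rewrite subr0.
Qed.

Lemma cocycleP n (z : cocycle R X A n) : cobound (cocycle_val z) = 0.
Proof. by apply/eqP; exact: (valP z). Qed.

Lemma represents_cocycle n (c : C n) (h : H n) : represents c h -> cobound c = 0.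
Proof. by move=> [z <- _]; exact: cocycleP. Qed.

Lemma represents_exists n (h : H n) : exists c : C n, represents c h.
Proof. by exists (cocycle_val (repr h)), (repr h) => //; rewrite reprK. Qed.

Lemma represents_of_cocycle n (c : C n) : cobound c = 0 ->
  exists h : H n, represents c h.
Proof.
move=> c0; have cz : c \in @cocycle_pred R X A n by apply/eqP.
by exists (\pi_(H n) (Cocycle cz)), (Cocycle cz).
Qed.

Lemma represents0P n (c : C n.+1) :
  represents c (0 : H n.+1) -> exists b : C n, c = cobound b.
Proof.
move=> [z <- ] /eqP.
by rewrite class_eq0 => /asboolP.
Qed.

Lemma represents_cobound1 (b : C 1) : represents (cobound b) (0 : H 2).
Proof.
have cz : cobound b \in @cocycle_pred R X A 2 by apply/eqP/cobound_cobound1.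
exists (Cocycle cz) => //.
by apply/eqP; rewrite class_eq0; apply/asboolP; exists b.
Qed.

Lemma representsMn n (c : C n) (h : H n) k :
  represents c h -> represents (c *+ k) (h *+ k).
Proof. 
move=> [z <- <-]; exists (z *+ k); last by rewrite raddfMn.
exact: (raddfMn (val : cocycle R X A n -> C n)).
Qed.

Lemma represents_sub n (c d : C n) (h : H n) :
  represents c h -> represents d h -> represents (c - d) (0 : H n).
Proof.
move=> [z <- <-] [w <- e]; exists (z - w); last first.
  by apply/eqP; rewrite raddfB subr_eq0; apply/eqP/esym.
exact: (raddfB (val : cocycle R X A n -> C n)).
Qed.

End Classes.

(** * Divided powers as defining systems *)

Section DefiningSystem.
Variables (R : realType) (X : topologicalType) (p : nat).
Hypothesis p_prime : prime p.
Notation C n := (cochain R X 'F_p n).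
Notation H n := (cohomology R X 'F_p n).

Lemma fact_Fp_neq0 n : (n < p)%N -> n`!%:R != 0 :> 'F_p.
Proof.
elim: n => [|n IH] np; first by rewrite fact0 oner_eq0.
rewrite factS natrM mulf_neq0 ?IH 1?ltnW //.
by rewrite -(dvdn_pcharf (pchar_Fp p_prime)) gtnNdvd.
Qed.

(** Off the corner [(0, k - 1)] the divided powers have order below [k], so their factorials are
    prime to [p] even when [k = p]. *)
Lemma dpcochain_defining_system (T : H 1) (t : C 1) k : represents t T ->
  (k <= p)%N -> defining_system (nseq k T) (fun i j => dpcochain t (j.+1 - i)).
Proof.
move=> tT kp; split=> [i|i j]; rewrite size_nseq.
  move=> ik; rewrite nth_nseq ik subSnn (_ : dpcochain t 1 = t) //.
  by apply/funext => s; rewrite /dpcochain /divpow expr0 expr1 divr1 mul1r.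
move=> /andP[ij jk] ijn; apply: cobound_dpcochain.
- exact: represents_cocycle tT.
- exact: ltnW.
- apply: fact_Fp_neq0; apply: leq_trans kp.
  by move: ijn; rewrite xpair_eqE; lia.
Qed.

End DefiningSystem.

Theorem massey_power_vanishes (R : realType) (X : topologicalType) (p k : nat)
  (T : cohomology R X 'F_p 1) : prime p -> (0 < k < p)%N ->
  massey_vanishes (nseq k T).
Proof.
move=> p_prime /andP[k0 kp]; have [t tT] := represents_exists T.
have sys := dpcochain_defining_system p_prime tT (ltnW kp).
split; first by eexists; exact: sys.
eexists; first exact: sys.
(* The product is the right-hand side of the equation at the corner [(0, k - 1)]; since [k!] is
   still invertible, the corner divided power exists and cobounds it. *)
rewrite size_nseq -cobound_dpcochain //; first exact: represents_cobound1.
  exact: represents_cocycle tT.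
by apply: fact_Fp_neq0; lia.
Qed.

(** * Barycentric coordinates *)

Section Barycentric.
Variable R : realType.
Notation D n := (stdsimplexT R n).

Definition bcoord n (x : D n) (i : 'I_n.+1) : R := set_val x ord0 i.

Lemma bcoord_ge0 n (x : D n) i : 0 <= bcoord x i.
Proof. by have /set_mem[h _] := valP x; exact: h. Qed.

Lemma bcoord_sum n (x : D n) : \sum_i bcoord x i = 1.
Proof. by have /set_mem[_ h] := valP x; exact: h. Qed.

Lemma bcoord_inj n (x y : D n) : (forall i, bcoord x i = bcoord y i) -> x = y.
Proof. by move=> xy; apply: val_inj; apply/rowP => i; exact: xy. Qed.

Lemma bcoord_continuous n (i : 'I_n.+1) : continuous (fun x : D n => bcoord x i).
Proof.
move=> x; apply: (@continuous_comp (D n) 'rV[R]_n.+1 R set_val (fun v => v ord0 i)).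
  exact: initial_continuous.
exact: coord_continuous.
Qed.

Lemma bcoord_push m n (f : 'I_m.+1 -> 'I_n.+1) (x : D m) j :
  bcoord (push f x) j = \sum_(i | f i == j) bcoord x i.
Proof. by rewrite /bcoord /= mxE. Qed.

Definition positive_part n (v : 'I_n.+1 -> R) i := Num.max 0 (v i).

(* The point with homogeneous barycentric coordinates [max 0 (v i)]; when
   all of these vanish, it is the vertex [ord0]. *)
Definition bary_row n (v : 'I_n.+1 -> R) : 'rV[R]_n.+1 :=
  let S := \sum_i positive_part v i in
  \row_i (if S == 0 then (i == ord0)%:R else positive_part v i / S).

Lemma positive_part_ge0 n (v : 'I_n.+1 -> R) i : 0 <= positive_part v i.
Proof. by rewrite le_max lexx. Qed.

Lemma bary_proof n (v : 'I_n.+1 -> R) : bary_row v \in @stdsimplex R n.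
Proof.
apply/mem_set; split=> [i|].
  rewrite mxE; case: ifP => _; first exact: ler0n.
  by rewrite divr_ge0 ?positive_part_ge0 ?sumr_ge0 // => j _; exact: positive_part_ge0.
under eq_bigr do rewrite mxE.
case: eqP => [_|/eqP S0]; last by rewrite -mulr_suml divff.
by rewrite (bigD1 ord0) //= big1 ?addr0 // => i /negPf ->.
Qed.

Definition bary n (v : 'I_n.+1 -> R) : D n :=
  exist (fun y => y \in @stdsimplex R n) _ (bary_proof v).

Lemma bcoord_bary n (v : 'I_n.+1 -> R) i : \sum_i positive_part v i != 0 ->
  bcoord (bary v) i = positive_part v i / \sum_i positive_part v i.
Proof. by move=> /negPf S0; rewrite /bcoord /= mxE S0. Qed.

Lemma bcoord_bary1 n (v : 'I_n.+1 -> R) i :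
  (forall i, 0 <= v i) -> \sum_i v i = 1 -> bcoord (bary v) i = v i.
Proof.
move=> v0 v1; have pv j : positive_part v j = v j by rewrite /positive_part max_r.
have S : \sum_i positive_part v i = 1 by under eq_bigr do rewrite pv.
by rewrite bcoord_bary S ?oner_eq0 // pv divr1.
Qed.

Lemma continuous_to_simplex n (T : topologicalType) (h : T -> D n) :
  (forall i, continuous (fun z => bcoord (h z) i)) -> continuous h.
Proof.
move=> ch; apply: continuous_comp_initial => z U [P nP PU].
rewrite nbhs_simpl /=; apply: (filterS (fun y => PU (set_val (h y)))).
suff : nbhs z [set y | forall i j, P i j (set_val (h y) i j)] by [].
apply: (@filter_forall _ _ (fun i => [set y | forall j, P i j (set_val (h y) i j)]) (nbhs z)) => i.
apply: (@filter_forall _ _ (fun j => [set y | P i j (set_val (h y) i j)]) (nbhs z)) => j.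
by rewrite (ord1 i); apply: (ch j z); have := nP i j; rewrite (ord1 i).
Qed.

Lemma bary_continuous n (T : topologicalType) (v : T -> 'I_n.+1 -> R) :
  (forall z, \sum_i positive_part (v z) i != 0) ->
  (forall i, continuous (fun z => v z i)) -> continuous (fun z => bary (v z)).
Proof.
move=> S0 cv; apply: continuous_to_simplex => i.
under eq_fun do rewrite bcoord_bary //.
have cp j : continuous (fun z => positive_part (v z) j).
  move=> z; apply: (@continuous_comp _ _ _ (fun z => v z j) (Num.max 0)); first exact: cv.
  by apply: (@continuous_max _ R (cst 0) id); [exact: cvg_cst|exact: cvg_id].
have cS : continuous (fun z => \sum_i positive_part (v z) i).
  by apply: continuous_big => //; exact: add_continuous.
by move=> z; apply: cvgM; [exact: cp|apply: cvgV => //; exact: cS].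
Qed.

Lemma bary_continuous1 n (T : topologicalType) (v : T -> 'I_n.+1 -> R) :
  (forall z i, 0 <= v z i) -> (forall z, \sum_i v z i = 1) ->
  (forall i, continuous (fun z => v z i)) -> continuous (fun z => bary (v z)).
Proof.
move=> v0 v1 cv; apply: bary_continuous => // z.
rewrite (eq_bigr (v z)) ?v1 ?oner_eq0 // => i _; by rewrite /positive_part max_r.
Qed.

End Barycentric.

(** * Loops as 1-simplices *)

Lemma continuous_compf (S T U : topologicalType) (f : S -> T) (g : T -> U) :
  continuous f -> continuous g -> continuous (fun x => g (f x)).
Proof. by move=> cf cg x; exact: continuous_comp (cf x) (cg _). Qed.

Lemma continuous_pairf (S T U : topologicalType) (f : S -> T) (g : S -> U) :
  continuous f -> continuous g -> continuous (fun x => (f x, g x)).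
Proof. by move=> cf cg x; apply: cvg_pair; [exact: cf|exact: cg]. Qed.

Lemma continuous_clampf (R : realType) (S : topologicalType) (h : S -> R) :
  continuous h -> continuous (fun z => clampI (h z)).
Proof. by move=> ch; exact: continuous_compf ch (@clampI_continuous R). Qed.

Lemma continuous_addf (R : realType) (S : topologicalType) (f g : S -> R) :
  continuous f -> continuous g -> continuous (fun z => f z + g z).
Proof. by move=> cf cg z; apply: cvgD; [exact: cf|exact: cg]. Qed.

Lemma continuous_oppf (R : realType) (S : topologicalType) (f : S -> R) :
  continuous f -> continuous (fun z => - f z).
Proof. by move=> cf z; apply: cvgN; exact: cf. Qed.

Lemma continuous_mulf (R : realType) (S : topologicalType) (f g : S -> R) :
  continuous f -> continuous g -> continuous (fun z => f z * g z).
Proof. by move=> cf cg z; apply: cvgM; [exact: cf|exact: cg]. Qed.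

Lemma continuous_cstf (S T : topologicalType) (c : T) : continuous (fun _ : S => c).
Proof. by move=> z; exact: cvg_cst. Qed.

Lemma continuous_ivalf (R : realType) (S : topologicalType) (h : S -> unitI R) :
  continuous h -> continuous (fun z => ival (h z)).
Proof. by move=> ch; apply: continuous_compf ch _; exact: initial_continuous. Qed.

Section EdgeCoordinates.
Variable R : realType.
Notation D n := (stdsimplexT R n).

Definition param (x : D 1) : R := bcoord x ord_max.

Lemma param_itv x : 0 <= param x <= 1.
Proof.
rewrite bcoord_ge0 /= -(bcoord_sum x) !big_ord_recl big_ord0 /= addr0.
by rewrite (_ : lift _ _ = ord_max) ?lerDr ?bcoord_ge0 //; apply: val_inj.
Qed.

Lemma bcoord0_param x : bcoord x ord0 = 1 - param x.
Proof.
rewrite -(bcoord_sum x) !big_ord_recl big_ord0 /= addr0.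
by rewrite (_ : lift _ _ = ord_max) ?addrK //; apply: val_inj.
Qed.

Lemma bcoord_edge n (u v w : 'I_n.+1) (x : D 1) :
  bcoord (push (fun k : 'I_2 => if k == ord0 then u else v) x) w =
  (u == w)%:R * (1 - param x) + (v == w)%:R * param x.
Proof.
rewrite bcoord_push big_mkcond !big_ord_recl big_ord0 /= addr0 -bcoord0_param.
rewrite /param (_ : lift _ _ = ord_max); last exact: val_inj.
by case: eqP; case: eqP; rewrite ?mul0r ?mul1r.
Qed.

End EdgeCoordinates.

Section LoopSimplex.
Variables (R : realType) (X : topologicalType).
Notation D n := (stdsimplexT R n).
Notation I := (unitI R).

Definition mksimplex n (h : D n -> X) (ch : continuous h) : simplex R X n :=
  @mkcts _ _ h ch.

Lemma edge_mksimplex n (h : D n -> X) (ch : continuous h) u v x :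
  edge (mksimplex ch) u v x = h (push (fun k : 'I_2 => if k == ord0 then u else v) x).
Proof. by []. Qed.

Lemma path_simplex_continuous (a : I -> X) : continuous a ->
  continuous (fun x : D 1 => a (clampI (param x))).
Proof.
by move=> ca; apply: continuous_compf ca; apply: continuous_clampf; exact: bcoord_continuous.
Qed.

Definition path_simplex (a : I -> X) (ca : continuous a) : simplex R X 1 :=
  mksimplex (path_simplex_continuous ca).

Variable x0 : X.
Notation L := (loop R X x0).

Definition loop_simplex (a : L) : simplex R X 1 :=
  path_simplex (@cts_fun _ _ (a : continuousType _ _)).

Definition const_simplex n : simplex R X n := mksimplex (@continuous_cstf _ _ x0).

Lemma loop_simplexE (a : L) x : loop_simplex a x = a (clampI (param x)).
Proof. by []. Qed.

(** * Functions on edges that are multiplicative on triangles *)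

Section Multiplicative.
Variables (M : nzRingType) (U : simplex R X 1 -> M).
Hypothesis UM : forall s : simplex R X 2,
  U (edge s v0 v1) * U (edge s v1 v2) = U (edge s v0 v2).
Hypothesis U1 : U (const_simplex 1) = 1.

(** The diagonal cuts the homotopy square into two triangles. Its vertical sides are constant, so
    [U] takes on both [a] and [b] its value on the diagonal. *)
Lemma homotopic_mult (a b : L) :
  loop_homotopic a b -> U (loop_simplex a) = U (loop_simplex b).
Proof.
move=> /asboolP[H [cH H0 H1 Hx]].
(* The triangle with vertices [(0, 0)], [(1, 0)], [(1, 1)]; the next one has [(0, 0)], [(0, 1)],
   [(1, 1)]. *)
have c1 : continuous (fun x : D 2 => H (clampI (bcoord x v1 + bcoord x v2), clampI (bcoord x v2))).
  apply: continuous_compf cH; apply: continuous_pairf; apply: continuous_clampf.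
    by apply: continuous_addf; exact: bcoord_continuous.
  exact: bcoord_continuous.
have c2 : continuous (fun x : D 2 => H (clampI (bcoord x v2), clampI (bcoord x v1 + bcoord x v2))).
  apply: continuous_compf cH; apply: continuous_pairf; apply: continuous_clampf.
    exact: bcoord_continuous.
  by apply: continuous_addf; exact: bcoord_continuous.
have := UM (mksimplex c1); have := UM (mksimplex c2).
have -> : edge (mksimplex c2) v0 v1 = const_simplex 1.
  apply: simplexP => x; rewrite !edge_mksimplex !bcoord_edge /= !mul0r !mul1r !add0r ?addr0.
  exact: (Hx _).1.
have -> : edge (mksimplex c1) v1 v2 = const_simplex 1.
  apply: simplexP => x; rewrite !edge_mksimplex !bcoord_edge /= !mul0r !mul1r !add0r ?addr0 subrK.
  exact: (Hx _).2.
have -> : edge (mksimplex c1) v0 v1 = loop_simplex a.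
  apply: simplexP => x; rewrite !edge_mksimplex !bcoord_edge /= !mul0r !mul1r !add0r ?addr0.
  exact: H0.
have -> : edge (mksimplex c2) v1 v2 = loop_simplex b.
  apply: simplexP => x; rewrite !edge_mksimplex !bcoord_edge /= !mul0r !mul1r !add0r ?addr0 subrK.
  exact: H1.
rewrite U1 mul1r mulr1 => -> ->; congr U.
by apply: simplexP => x; rewrite !edge_mksimplex !bcoord_edge /= !mul0r !mul1r !add0r ?addr0.
Qed.

(** Map the triangle affinely onto the interval with vertices going to 0, 1/2 and 1: under the
    concatenation its short edges become [a] and [b]. *)
Lemma concat_mult (a b : L) :
  U (loop_simplex (concat a b)) = U (loop_simplex a) * U (loop_simplex b).
Proof.
have c1 : continuous (fun x : D 2 => concat a b (clampI (bcoord x v1 * 2^-1 + bcoord x v2))).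
  apply: continuous_compf (@cts_fun _ _ (concat a b : continuousType _ _)).
  apply: continuous_clampf; apply: continuous_addf; last exact: bcoord_continuous.
  by apply: continuous_mulf; [exact: bcoord_continuous|exact: continuous_cstf].
have := UM (mksimplex c1).
have -> : edge (mksimplex c1) v0 v1 = loop_simplex a.
  apply: simplexP => x; rewrite !edge_mksimplex !bcoord_edge /= !mul0r !mul1r !add0r ?addr0.
  have /andP[t0 t1] := param_itv x.
  rewrite -[LHS]/(concat_fun a b _) /concat_fun ival_clampI; last by lra.
  by rewrite ifT; [apply: (congr1 (fun t => a (clampI t))); field|lra].
have -> : edge (mksimplex c1) v1 v2 = loop_simplex b.
  apply: simplexP => x; rewrite !edge_mksimplex !bcoord_edge /= !mul0r !mul1r !add0r ?addr0.
  have /andP[t0 t1] := param_itv x.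
  rewrite -[LHS]/(concat_fun a b _) /concat_fun ival_clampI; last by lra.
  rewrite -[RHS]/(b (clampI (param x))).
  have -> : (1 - param x) / 2 + param x = (1 + param x) / 2 by field.
  (* [concat_fun] assigns the midpoint to its first half, so the start of [b] appears there as the
     end of [a]. *)
  case: ifPn => [h|h].
    have -> : param x = 0 by lra.
    have -> : 2 * ((1 + 0) / 2) = 1 :> R by field.
    by rewrite [LHS]path_one [RHS]path_zero.
  by apply: (congr1 (fun t => b (clampI t))); field.
move=> ->; congr U.
by apply: simplexP => x; rewrite !edge_mksimplex !bcoord_edge /= !mul0r !mul1r !add0r mul0r add0r.
Qed.

End Multiplicative.

End LoopSimplex.

(** * Vertices, and the 1-simplex as an interval *)

Section Vertices.
Variable R : realType.
Notation D n := (stdsimplexT R n).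
Notation I := (unitI R).

Definition vertex n (i : 'I_n.+1) : D n := bary (fun j => (i == j)%:R).

Lemma bcoord_vertex n (i j : 'I_n.+1) : bcoord (vertex i) j = (i == j)%:R.
Proof.
rewrite bcoord_bary1 //.
by rewrite (bigD1 i) //= eqxx big1 ?addr0 // => k; rewrite eq_sym => /negPf ->.
Qed.

Lemma push_vertex m n (f : 'I_m.+1 -> 'I_n.+1) i : push f (vertex i) = vertex (f i).
Proof.
apply: bcoord_inj => j; rewrite bcoord_push bcoord_vertex big_mkcond (bigD1 i) //=.
rewrite bcoord_vertex eqxx big1 ?addr0; first by case: eqP.
by move=> k ki; rewrite bcoord_vertex [i == k]eq_sym (negPf ki) if_same.
Qed.

Definition segment (t : I) : D 1 :=
  bary (fun k : 'I_2 => if k == ord0 then 1 - ival t else ival t).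

Lemma param_segment t : param (segment t) = ival t.
Proof.
have /andP[t0 t1] := ival_itv t.
rewrite /param bcoord_bary1 // => [k|]; first by case: ifP; rewrite ?subr_ge0.
by rewrite !big_ord_recl big_ord0 /= addr0 subrK.
Qed.

Lemma param_inj (x y : D 1) : param x = param y -> x = y.
Proof.
move=> xy; apply: bcoord_inj => i.
by have [->|/ord2_neq0 -> //] := eqVneq i ord0; rewrite !bcoord0_param xy.
Qed.

Lemma segmentK x : segment (clampI (param x)) = x.
Proof. by apply: param_inj; rewrite param_segment ival_clampI // param_itv. Qed.

Lemma segment_continuous : continuous segment.
Proof.
apply: bary_continuous1 => [t i|t|i].
- by have /andP[t0 t1] := ival_itv t; case: ifP; rewrite ?subr_ge0.
- by rewrite !big_ord_recl big_ord0 /= addr0 subrK.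
- have ci : continuous (fun t : I => ival t) by apply: continuous_ivalf => t; exact: cvg_id.
  case: (i == ord0) => //; 
  apply: continuous_addf; first exact: continuous_cstf.
  exact: continuous_oppf.
Qed.

Lemma ival_zero : ival (zero : I) = 0.
Proof. by rewrite ival_clampI // lexx ler01. Qed.

Lemma ival_one : ival (one : I) = 1.
Proof. by rewrite ival_clampI // lexx ler01. Qed.

Lemma segment_zero : segment zero = vertex ord0.
Proof. by apply: param_inj; rewrite param_segment /param bcoord_vertex ival_zero. Qed.

Lemma segment_one : segment one = vertex ord_max.
Proof. by apply: param_inj; rewrite param_segment /param bcoord_vertex ival_one. Qed.

End Vertices.

(** * Edges that are loops at the base point *)

Section LoopOfSimplex.
Variables (R : realType) (X : topologicalType) (x0 : X).
Notation D n := (stdsimplexT R n).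
Notation I := (unitI R).
Notation L := (loop R X x0).

Lemma simplex_continuous n (s : simplex R X n) : continuous s.
Proof. exact: cts_fun. Qed.

Lemma loop_of_simplex (s : simplex R X 1) :
  s (vertex R ord0) = x0 -> s (vertex R ord_max) = x0 ->
  exists l : L, loop_simplex l = s.
Proof.
move=> s0 s1.
have cl : continuous (fun t : I => s (segment t)).
  exact: continuous_compf (@segment_continuous R) (@simplex_continuous _ s).
have l0 : s (segment zero) = x0 by rewrite segment_zero.
have l1 : s (segment one) = x0 by rewrite segment_one.
exists (mk_path cl l0 l1); apply: simplexP => x.
by rewrite -[LHS]/(s (segment (clampI (param x)))) segmentK.
Qed.

Lemma loop_simplex_segment (l : L) t : loop_simplex l (segment t) = l t.
Proof. by rewrite loop_simplexE param_segment clampIK. Qed.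

Lemma loop_simplex_vertex0 (l : L) : loop_simplex l (vertex R ord0) = x0.
Proof. by rewrite -segment_zero loop_simplex_segment path_zero. Qed.

Lemma loop_simplex_vertex1 (l : L) : loop_simplex l (vertex R ord_max) = x0.
Proof. by rewrite -segment_one loop_simplex_segment path_one. Qed.

Lemma triangle_homotopic (s : simplex R X 2) (a b c : L) :
  loop_simplex a = edge s v0 v1 -> loop_simplex b = edge s v1 v2 ->
  loop_simplex c = edge s v0 v2 -> loop_homotopic (concat a b) c.
Proof.
move=> ea eb ec.
(* Straight-line homotopy from the path [P] along two edges to the third edge [Q]. *)
pose P (t : R) (k : 'I_3) : R :=
  let q0 := Num.max 0 (1 - 2 * t) in let q2 := Num.max 0 (2 * t - 1) in
  if k == v0 then q0 else if k == v2 then q2 else 1 - q0 - q2.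
pose Q (t : R) (k : 'I_3) : R :=
  if k == v0 then 1 - t else if k == v2 then t else 0.
pose w (z : I * I) (k : 'I_3) : R :=
  (1 - ival z.2) * P (ival z.1) k + ival z.2 * Q (ival z.1) k.
have w0 z k : 0 <= w z k.
  have /andP[t0 t1] := ival_itv z.1; have /andP[u0 u1] := ival_itv z.2.
  rewrite /w addr_ge0 // mulr_ge0 ?subr_ge0 // /P /Q.
    case: (lerP 0 (1 - 2 * ival z.1)) => ?; case: (lerP 0 (2 * ival z.1 - 1)) => ?;
    by do 2?[case: ifP => _]; lra.
  by do 2?[case: ifP => _]; lra.
have w1 z : \sum_k w z k = 1.
  by rewrite !big_ord_recl big_ord0 /w /P /Q /=; ring.
have cw k : continuous (fun z => w z k).
  have ct : continuous (fun z : I * I => ival z.1) by apply: continuous_ivalf => z; exact: cvg_fst.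
  have cu : continuous (fun z : I * I => ival z.2) by apply: continuous_ivalf => z; exact: cvg_snd.
  have cst (r : R) : continuous (fun z : I * I => r) by exact: continuous_cstf.
  have cmax (f : I * I -> R) : continuous f -> continuous (fun z => Num.max 0 (f z)).
    move=> cf; apply: continuous_compf cf _ => r.
    by apply: (@continuous_max _ R (fun=> 0) id); [exact: cvg_cst|exact: cvg_id].
  have c0 := cmax _ (continuous_addf (cst 1)
    (continuous_oppf (continuous_mulf (cst 2) ct))).
  have c2 := cmax _ (continuous_addf (continuous_mulf (cst 2) ct) (cst (- 1))).
  have cP : continuous (fun z : I * I => P (ival z.1) k).
    rewrite /P; case: (k == v0) => //; case: (k == v2) => //.
    exact: continuous_addf (continuous_addf (cst 1) (continuous_oppf c0))
      (continuous_oppf c2).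
  have cQ : continuous (fun z : I * I => Q (ival z.1) k).
    rewrite /Q; case: (k == v0).
      exact: continuous_addf (cst 1) (continuous_oppf ct).
    by case: (k == v2); [exact: ct|exact: cst].
  exact: continuous_addf
    (continuous_mulf (continuous_addf (cst 1) (continuous_oppf cu)) cP)
    (continuous_mulf cu cQ).
apply/asboolP; exists (fun z => s (bary (w z))); split.
- apply: continuous_compf (@simplex_continuous _ s).
  exact: bary_continuous1.
- move=> t; rewrite -[RHS]/(concat_fun a b t) /concat_fun.
  have /andP[t0 t1] := ival_itv t.
  case: ifPn => ht; rewrite -loop_simplex_segment ?ea ?eb; congr (s _);
    apply: bcoord_inj => k; rewrite bcoord_bary1 // bcoord_edge param_segment /w /=
    ival_zero ival_clampI; try lra;
    case: k => -[|[|[|//]]] ik; rewrite /P /Q /=;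
    case: (lerP 0 (1 - 2 * ival t)) => ?; case: (lerP 0 (2 * ival t - 1)) => ?; lra.
- move=> t; rewrite -loop_simplex_segment ec; congr (s _).
  apply: bcoord_inj => k; rewrite bcoord_bary1 // bcoord_edge param_segment /w /= ival_one.
  by case: k => -[|[|[|//]]] ik; rewrite /Q /=; ring.
- move=> u; split;
    [ rewrite -[RHS](loop_simplex_vertex0 a) ea
    | rewrite -[RHS](loop_simplex_vertex1 b) eb ];
    rewrite /edge /= push_vertex; congr (s _); apply: bcoord_inj => k;
    rewrite bcoord_vertex bcoord_bary1 // /w /P /Q /= ?ival_zero ?ival_one;
    case: k => -[|[|[|//]]] ik /=;
    do 2?[case: lerP => ?]; lra.
Qed.

Variables (A : zmodType) (phi : L -> A).
Hypothesis phi_homotopic : forall a b, loop_homotopic a b -> phi a = phi b.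
Hypothesis phi_concat : forall a b, phi (concat a b) = phi a + phi b.

(** The default 0 on edges that are not loops at [x0] keeps additivity on triangles with no vertex
    at [x0]. *)
Definition loop_value (s : simplex R X 1) : A :=
  if pselect (exists l : L, loop_simplex l = s) is left h then phi (projT1 (cid h)) else 0.

Lemma loop_valueE l : loop_value (loop_simplex l) = phi l.
Proof.
rewrite /loop_value; case: pselect => [h|]; last by case; exists l.
case: cid => l' /= ll; congr phi; apply/path_eqP => t.
by rewrite -!loop_simplex_segment ll.
Qed.

Lemma loop_value_nonloop (s : simplex R X 1) : s (vertex R ord0) != x0 -> loop_value s = 0.
Proof.
move=> s0; rewrite /loop_value; case: pselect => // h; exfalso.
by case: h => l ls; move: s0; rewrite -ls loop_simplex_vertex0 eqxx.
Qed.

(** Mixed triangles are excluded: if only the middle vertex avoids [x0], the short edges get 0 while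
    the long one is a loop of arbitrary value. *)
Lemma loop_value_triangle (s : simplex R X 2) :
  (forall i, s (vertex R i) = x0) \/ (forall i, s (vertex R i) <> x0) ->
  loop_value (edge s v0 v2) = loop_value (edge s v0 v1) + loop_value (edge s v1 v2).
Proof.
case=> sx; last first.
  rewrite !loop_value_nonloop ?addr0 //; apply/eqP; rewrite /edge /= push_vertex; exact: sx.
have lp u v : exists l : L, loop_simplex l = edge s u v.
  by apply: loop_of_simplex; rewrite /edge /= push_vertex; exact: sx.
have [a ea] := lp v0 v1; have [b eb] := lp v1 v2; have [c ec] := lp v0 v2.
rewrite -ea -eb -ec !loop_valueE -phi_concat; apply/esym/phi_homotopic.
exact: triangle_homotopic ea eb ec.
Qed.

End LoopOfSimplex.

(** * A cocycle extending a morphism on loops *)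

Section Shrink.
Variable R : realType.
Notation D n := (stdsimplexT R n).

(** Collapses each corner region, where one coordinate is at least 3/4, to its vertex, which frees
    these regions for whiskers. *)
Definition shrink n (x : D n) : D n := bary (fun i => bcoord x i - 4^-1).

(** The shifted coordinates add up to [1 - (n + 1) / 4], which is positive for [n < 3]. *)
Lemma shrink_sum_neq0 n (x : D n) : (n < 3)%N ->
  \sum_i positive_part (fun i => bcoord x i - 4^-1) i != 0.
Proof.
move=> n3; apply: lt0r_neq0.
apply: (@lt_le_trans _ _ (\sum_i (bcoord x i - 4^-1))).
  rewrite sumrB bcoord_sum sumr_const card_ord subr_gt0.
  rewrite -[_ *+ _]mulr_natr mulrC ltr_pdivrMr // mul1r ltr_nat; lia.
by apply: ler_sum => i _; rewrite le_max lexx orbT.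
Qed.

Lemma shrink_continuous n : (n < 3)%N -> continuous (@shrink n).
Proof.
move=> n3; apply: bary_continuous => [x|i]; first exact: shrink_sum_neq0.
by apply: continuous_addf; [exact: bcoord_continuous|exact: continuous_cstf].
Qed.

Lemma bcoord_le_compl n (x : D n) i j : i != j -> bcoord x j <= 1 - bcoord x i.
Proof.
move=> ij; rewrite lerBrDl -(bcoord_sum x) (bigD1 i) //= lerD2l (bigD1 j) 1?eq_sym //=.
by rewrite lerDl sumr_ge0 // => k _; exact: bcoord_ge0.
Qed.

(** The other coordinates total at most 1/4, so nothing positive is left of them after the shift. *)
Lemma shrink_corner n (x : D n) i : 3 / 4 <= bcoord x i -> shrink x = vertex R i.
Proof.
move=> xi; apply: bcoord_inj => j; rewrite bcoord_vertex.
have p0 k : k != i -> positive_part (fun i => bcoord x i - 4^-1) k = 0.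
  move=> ki; apply/max_l; have := @bcoord_le_compl _ x i k; rewrite eq_sym => /(_ ki); lra.
have S : \sum_i positive_part (fun i => bcoord x i - 4^-1) i =
    positive_part (fun i => bcoord x i - 4^-1) i.
  by rewrite (bigD1 i) //= big1 ?addr0.
have pi : 0 < positive_part (fun i => bcoord x i - 4^-1) i.
  by rewrite lt_max; apply/orP; right; lra.
rewrite bcoord_bary S ?lt0r_neq0 //.
have [<-|ij] := eqVneq i j; first by rewrite divff // lt0r_neq0.
by rewrite p0 ?mul0r // eq_sym.
Qed.

Lemma shrink_vertex n (i : 'I_n.+1) : shrink (vertex R i) = vertex R i.
Proof. by apply: shrink_corner; rewrite bcoord_vertex eqxx /=; lra. Qed.

Lemma bcoord_push_inj m n (f : 'I_m.+1 -> 'I_n.+1) (x : D m) i :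
  injective f -> bcoord (push f x) (f i) = bcoord x i.
Proof.
move=> fI; rewrite bcoord_push (eq_bigl (pred1 i)) ?big_pred1_eq // => j.
exact: inj_eq.
Qed.

(** For injective [f] the coordinates of [push f x] are those of [x] and zeros, and the zeros are
    truncated back to 0. Without injectivity, coordinates would be added before the shift. *)
Lemma push_shrink m n (f : 'I_m.+1 -> 'I_n.+1) (x : D m) : injective f ->
  (n < 3)%N -> (m < 3)%N -> push f (shrink x) = shrink (push f x).
Proof.
move=> fI n3 m3; have S := shrink_sum_neq0 (push f x) n3.
apply: bcoord_inj => j; rewrite bcoord_push bcoord_bary //.
have pE k : positive_part (fun i => bcoord (push f x) i - 4^-1) k =
    \sum_(i | f i == k) positive_part (fun i => bcoord x i - 4^-1) i.
  have [[i <-]|nk] := pselect (exists i, f i = k).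
    rewrite {1}/positive_part bcoord_push_inj // (eq_bigl (pred1 i)) ?big_pred1_eq //.
    by move=> j'; exact: inj_eq.
  have fk i : (f i == k) = false by apply/eqP => fik; apply: nk; exists i.
  rewrite big_pred0 // {1}/positive_part bcoord_push big_pred0 // sub0r.
  by apply: max_l; rewrite oppr_le0 invr_ge0.
have -> : \sum_k positive_part (fun i => bcoord (push f x) i - 4^-1) k =
    \sum_i positive_part (fun i => bcoord x i - 4^-1) i.
  by rewrite [RHS](partition_big f xpredT) //; apply: eq_bigr => k _; exact: pE.
rewrite pE mulr_suml.
by apply: eq_bigr => i _; rewrite bcoord_bary // shrink_sum_neq0.
Qed.

End Shrink.

(** * Attaching whiskers at the corners of a simplex *)

Section Whiskers.
Variables (R : realType) (X : topologicalType).
Notation D n := (stdsimplexT R n).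
Notation I := (unitI R).
Variable g : X -> I -> X.
Hypothesis gc : forall x, continuous (g x).
Hypothesis g1 : forall x, g x one = x.

(** The corners in [l] are glued on one at a time, so that continuity follows by induction from
    [continuous_glue]. The parameter [4 * (1 - x_i)] goes from 0 at vertex [i] to 1 on the wall
    [x_i = 3/4]. *)
Definition whisker_fold n (s : simplex R X n) (x : D n) (l : seq 'I_n.+1) : X :=
  foldr (fun i y => if bcoord x i <= 3 / 4 then y
                    else g (s (vertex R i)) (clampI (4 * (1 - bcoord x i))))
    (s (shrink x)) l.

Lemma whisker_fold_base n (s : simplex R X n) x l :
  (forall i, bcoord x i <= 3 / 4) -> whisker_fold s x l = s (shrink x).
Proof. by move=> h; elim: l => //= i l ->; rewrite h. Qed.

(** The matching condition for the gluing: on the wall [shrink] has reached vertex [i] and the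
    whisker has reached its end. *)
Lemma whisker_boundary n (s : simplex R X n) x i l : bcoord x i = 3 / 4 ->
  whisker_fold s x l = g (s (vertex R i)) (clampI (4 * (1 - bcoord x i))).
Proof.
move=> xi; rewrite whisker_fold_base => [|j].
  have -> : 4 * (1 - bcoord x i) = 1 by lra.
  by rewrite (@shrink_corner _ _ _ i) ?xi // [RHS]g1.
have [<-|ij] := eqVneq i j; first by rewrite xi.
have := bcoord_le_compl x ij; lra.
Qed.

(** Two coordinates cannot both exceed 3/4, so the order of [l] is irrelevant. *)
Lemma whisker_fold_corner n (s : simplex R X n) x i l : i \in l ->
  3 / 4 <= bcoord x i ->
  whisker_fold s x l = g (s (vertex R i)) (clampI (4 * (1 - bcoord x i))).
Proof.
move=> il; rewrite le_eqVlt => /orP[/eqP xi|xi]; first exact: whisker_boundary.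
elim: l il => //= j l IH; rewrite inE; have [<-|ij] := eqVneq i j => /= il.
  by rewrite ifN // -ltNge.
rewrite ifT ?IH //; have := bcoord_le_compl x ij; lra.
Qed.

Lemma whisker_fold_continuous n (s : simplex R X n) l : (n < 3)%N ->
  continuous (fun x => whisker_fold s x l).
Proof.
move=> n3; elim: l => [|i l IH] /=.
  exact: continuous_compf (shrink_continuous n3) (@simplex_continuous _ _ _ s).
apply: continuous_glue => // [||x xi]; first exact: bcoord_continuous.
  have cg := @gc (s (vertex R i)).
  apply: (continuous_compf _ cg); apply: continuous_clampf.
  apply: continuous_mulf; first exact: continuous_cstf.
  apply: continuous_addf; first exact: continuous_cstf.
  by apply: continuous_oppf; exact: bcoord_continuous.
exact: whisker_boundary.
Qed.

(* The simplex [s] shrunk into the middle; near corner [i] the map depends only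
   on the coordinate [i] and runs along the path from [s (vertex i)] back to the
   start of the whisker.  The bound [n < 3] makes some coordinate exceed [1/4],
   so that [shrink] is never normalising the zero vector. *)
Definition extend n (n3 : (n < 3)%N) (s : simplex R X n) : simplex R X n :=
  mksimplex (whisker_fold_continuous (s := s) (l := enum 'I_n.+1) n3).

Lemma extend_corner n (n3 : (n < 3)%N) (s : simplex R X n) x i :
  3 / 4 <= bcoord x i ->
  extend n3 s x = g (s (vertex R i)) (clampI (4 * (1 - bcoord x i))).
Proof. by apply: whisker_fold_corner; rewrite mem_enum. Qed.

Lemma extend_vertex n (n3 : (n < 3)%N) (s : simplex R X n) i :
  extend n3 s (vertex R i) = g (s (vertex R i)) zero.
Proof.
have e : bcoord (vertex R i) i = 1 by rewrite bcoord_vertex eqxx.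
by rewrite (@extend_corner _ _ _ _ i) e ?subrr ?mulr0 //; lra.
Qed.

(** In a corner only one coordinate counts, and an injective [f] preserves it; elsewhere
    [push_shrink] applies. This naturality lets triangle identities for extended simplices be read
    on edges. *)
Lemma extend_restr m n (m3 : (m < 3)%N) (n3 : (n < 3)%N) (f : 'I_m.+1 -> 'I_n.+1)
    (s : simplex R X n) : injective f ->
  restr f (extend n3 s) = extend m3 (restr f s).
Proof.
move=> fI; apply: simplexP => x; rewrite -[LHS]/(extend n3 s (push f x)).
have [[i xi]|h] := pselect (exists i, 3 / 4 <= bcoord x i).
  rewrite (extend_corner _ _ xi) (@extend_corner _ _ _ _ (f i)) bcoord_push_inj //.
  by rewrite -[restr f s _]/(s (push f _)) push_vertex.
have {}h i : bcoord x i <= 3 / 4.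
  by case: (lerP (bcoord x i) (3 / 4)) => // /ltW xi; case: h; exists i.
rewrite -[LHS]/(whisker_fold s _ _) -[RHS]/(whisker_fold (restr f s) _ _).
rewrite !whisker_fold_base // => [|j]; first by rewrite -push_shrink.
have [[i <-]|nj] := pselect (exists i, f i = j); first by rewrite bcoord_push_inj.
rewrite bcoord_push big_pred0 => [|i]; first by lra.
by apply/eqP => fij; apply: nj; exists i.
Qed.

Lemma extend_edge (s : simplex R X 2) (u v : 'I_3) : u != v ->
  edge (@extend 2 isT s) u v = @extend 1 isT (edge s u v).
Proof.
move=> uv; apply: extend_restr => i j.
have [->|/ord2_neq0 ->] := eqVneq i ord0; have [->|/ord2_neq0 ->] := eqVneq j ord0 => //= e.
  by rewrite e eqxx in uv.
by rewrite e eqxx in uv.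
Qed.

Lemma extend_cst n (n3 : (n < 3)%N) (s : simplex R X n) x :
  (forall i t, g (s (vertex R i)) t = s (vertex R i)) ->
  extend n3 s x = s (shrink x).
Proof.
move=> gs; have [[i xi]|h] := pselect (exists i, 3 / 4 <= bcoord x i).
  by rewrite (extend_corner _ _ xi) gs (shrink_corner xi).
apply: whisker_fold_base => i.
by case: (lerP (bcoord x i) (3 / 4)) => // /ltW xi; case: h; exists i.
Qed.

End Whiskers.

(** * The path component of the base point and the extended cocycle *)

Section Reachability.
Variables (R : realType) (X : topologicalType) (x0 : X).
Notation D n := (stdsimplexT R n).
Notation I := (unitI R).
Notation L := (loop R X x0).

Definition reachable (x : X) : Prop :=
  exists h : I -> X, [/\ continuous h, h zero = x0 & h one = x].

(** A path to vertex [i] is continued by the image under [s] of the segment from vertex [i] to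
    vertex [j]. *)
Lemma reachable_vertex n (s : simplex R X n) i j :
  reachable (s (vertex R i)) -> reachable (s (vertex R j)).
Proof.
move=> [h [ch h0 h1]].
pose w (r : R) (k : 'I_n.+1) : R := (1 - r) * (i == k)%:R + r * (j == k)%:R.
have cI : continuous (fun t : I => ival t) by apply: continuous_ivalf => t; exact: cvg_id.
have S r : \sum_k w r k = 1.
  rewrite /w big_split /= -!mulr_sumr.
  rewrite (bigD1 i) //= eqxx big1 ?addr0; last by move=> k; rewrite eq_sym => /negPf ->.
  rewrite (bigD1 j) //= eqxx big1 ?addr0; last by move=> k; rewrite eq_sym => /negPf ->.
  by rewrite !mulr1 subrK.
have c2 : continuous (fun t : I => s (bary (w (ival (clampI (2 * ival t - 1)))))).
  apply: continuous_compf _ (@simplex_continuous _ _ _ s).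
  apply: bary_continuous1 => // [t k|k].
    have /andP[t0 t1] := ival_itv (clampI (2 * ival t - 1)).
    by rewrite addr_ge0 // mulr_ge0 ?subr_ge0.
  have c : continuous (fun t : I => ival (clampI (2 * ival t - 1))).
    apply: continuous_ivalf; apply: continuous_clampf.
    apply: continuous_addf; last exact: continuous_cstf.
    by apply: continuous_mulf => //; exact: continuous_cstf.
  apply: continuous_addf; apply: continuous_mulf => //; try exact: continuous_cstf.
  by apply: continuous_addf; [exact: continuous_cstf|exact: continuous_oppf].
have wv (r : R) (k : 'I_n.+1) : (forall l, w r l = (k == l)%:R) -> bary (w r) = vertex R k.
  by move=> e; congr bary; apply/funext.
exists (fun t => if ival t <= 2^-1 then h (clampI (2 * ival t))
  else s (bary (w (ival (clampI (2 * ival t - 1)))))); split.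
- apply: continuous_glue => // [|t ->].
    apply: continuous_compf _ ch; apply: continuous_clampf.
    by apply: continuous_mulf => //; exact: continuous_cstf.
  rewrite mulfV ?pnatr_eq0 // subrr [LHS]h1 ival_zero (wv _ i) // => l.
  by rewrite /w subr0 mul1r mul0r addr0.
- by rewrite ival_zero mulr0 ifT ?invr_ge0 // [LHS]h0.
- rewrite ival_one ifF; last by apply/negP; lra.
  rewrite mulr1 (_ : 2 - 1 = 1); last by lra.
  rewrite ival_one (wv _ j) // => l.
  by rewrite /w subrr mul1r mul0r add0r.
Qed.

(** Choose a path from [x0] to each reachable point, the constant one at [x0] itself, and the
    constant path at every unreachable point. *)
Lemma whiskers : exists g : X -> I -> X,
  [/\ forall x, continuous (g x), forall x, g x one = x,
      forall t, g x0 t = x0 & forall x, g x zero = x0 <-> reachable x].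
Proof.
have r0 : reachable x0 by exists (fun=> x0); split=> //; exact: continuous_cstf.
have ex x : exists h : I -> X, [/\ continuous h, h one = x,
    x = x0 -> forall t, h t = x0 & h zero = x0 <-> reachable x].
  have [->|xx0] := pselect (x = x0).
    by exists (fun=> x0); split=> //; exact: continuous_cstf.
  have [rx|nx] := pselect (reachable x).
    by have [h [ch h0 h1]] := rx; exists h; split=> //.
  by exists (fun=> x); split=> //; exact: continuous_cstf.
have [g gP] := choice ex; exists g; split=> [x|x|t|x]; try by have [] := gP x.
by have [_ _ h _] := gP x0; exact: h.
Qed.

Variables (A : comNzRingType) (phi : L -> A).
Hypothesis phi_homotopic : forall a b, loop_homotopic a b -> phi a = phi b.
Hypothesis phi_concat : forall a b, phi (concat a b) = phi a + phi b.

(** [b] is [a] reparametrised by [shrink], which fixes both ends of the interval; the parameter is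
    moved linearly back to the identity. *)
Lemma loop_homotopic_shrink (a b : L) :
  (forall t, b t = loop_simplex a (shrink (segment t))) -> loop_homotopic b a.
Proof.
move=> bE; apply/asboolP.
have cs : continuous (fun z : I * I => segment z.1).
  by apply: continuous_compf (@segment_continuous R) => z; exact: cvg_fst.
have c1 : continuous (fun z : I * I => ival z.1) by apply: continuous_ivalf => z; exact: cvg_fst.
have c2 : continuous (fun z : I * I => ival z.2) by apply: continuous_ivalf => z; exact: cvg_snd.
exists (fun z => a (clampI ((1 - ival z.2) * param (shrink (segment z.1)) + ival z.2 * ival z.1))).
split=> [|t|t|u] /=.
- apply: continuous_compf _ (@cts_fun _ _ (a : continuousType _ _)).
  apply: continuous_clampf; apply: continuous_addf; apply: continuous_mulf => //.
    by apply: continuous_addf; [exact: continuous_cstf|exact: continuous_oppf].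
  have cp : continuous (@param R) by exact: bcoord_continuous.
  apply: continuous_compf _ cp; apply: continuous_compf cs _.
  exact: shrink_continuous.
- by rewrite ival_zero subr0 mul1r mul0r addr0 bE loop_simplexE.
- by rewrite ival_one subrr mul0r mul1r add0r clampIK.
- split.
    rewrite segment_zero shrink_vertex.
    by rewrite /param bcoord_vertex ival_zero !mulr0 addr0 [LHS]path_zero.
  rewrite segment_one shrink_vertex.
  by rewrite /param bcoord_vertex ival_one eqxx !mulr1 subrK [LHS]path_one.
Qed.

(** Whiskers turn an edge in the component of [x0] into a loop, on which [phi] is evaluated. For a
    loop at [x0] they are constant and merely reparametrise it. *)
Theorem cocycle_of_pi1_morphism : exists c : cochain R X A 1,
  cobound c = 0 /\ forall l : L, c (loop_simplex l) = phi l.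
Proof.
have [g [gc g1 gx0 g0]] := whiskers.
exists (fun s => loop_value phi (extend gc g1 (isT : (1 < 3)%N) s)); split.
  apply/funext => s; rewrite cobound1E -!extend_edge //.
  rewrite (loop_value_triangle phi_homotopic phi_concat (s := extend gc g1 (isT : (2 < 3)%N) s)).
    by rewrite -[RHS]/(0 : A); ring.
  (* The vertices of a triangle are all reachable or all unreachable, so after extension all or none
     of them lie at [x0]. *)
  have [r|nr] := pselect (reachable (s (vertex R ord0))).
    by left=> i; rewrite extend_vertex; apply/g0; exact: reachable_vertex r.
  right=> i; rewrite extend_vertex => /g0 r; apply: nr; exact: reachable_vertex r.
move=> l; set s := loop_simplex l.
have sv i : s (vertex R i) = x0.
  case: i => -[|[|//]] i; [rewrite -(loop_simplex_vertex0 l)|rewrite -(loop_simplex_vertex1 l)];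
    by congr (s (vertex R _)); apply: val_inj.
have [l' el'] : exists l' : L, loop_simplex l' = extend gc g1 (isT : (1 < 3)%N) s.
  by apply: loop_of_simplex; rewrite extend_vertex sv gx0.
rewrite -el' loop_valueE; apply: (@phi_homotopic l' l); apply: loop_homotopic_shrink => t.
by rewrite -loop_simplex_segment el' extend_cst // => i t'; rewrite sv gx0.
Qed.

End Reachability.

(** * Unitriangular matrices of a complete defining system *)

Section StrictlyUpper.
Variables (K : comNzRingType) (n : nat) (N : 'M[K]_n.+1).
Hypothesis Nup : forall i j : 'I_n.+1, (j <= i)%N -> N i j = 0.

(** Each of the [m] factors raises the index by at least one. *)
Lemma strict_upper_expr m (i j : 'I_n.+1) : (j < i + m)%N -> (N ^+ m) i j = 0.
Proof.
elim: m i j => [|m IH] i j.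
  by rewrite addn0 expr0 mxE => ji; case: eqP ji => // ->; rewrite ltnn.
rewrite exprS mxE => jim; apply: big1 => k _.
have [ki|ik] := leqP k i; first by rewrite Nup ?mul0r.
by rewrite IH ?mulr0 //; lia.
Qed.

Lemma strict_upper_nilpotent : N ^+ n.+1 = 0.
Proof.
apply/matrixP => i j; rewrite strict_upper_expr ?mxE //.
by have := ltn_ord j; lia.
Qed.

(** Only the chain of [n] unit steps leads from the first index to the last, so the corner is a
    product of superdiagonal entries. *)
Lemma strict_upper_corner (t : K) :
  (forall i j : 'I_n.+1, j = i.+1 :> nat -> N i j = t) ->
  (N ^+ n) ord0 ord_max = t ^+ n.
Proof.
move=> Nt.
suff E m (i j : 'I_n.+1) : j = (i + m)%N :> nat -> (N ^+ m) i j = t ^+ m by apply: E.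
elim: m i j => [|m IH] i j jim.
  by rewrite !expr0 mxE (_ : i == j) //; apply/eqP/val_inj; rewrite /= jim addn0.
have ik : (i.+1 < n.+1)%N by have := ltn_ord j; lia.
rewrite !exprS mxE (bigD1 (Ordinal ik)) //= big1 ?addr0 => [|k ki].
  by rewrite (Nt _ (Ordinal ik)) ?IH //=; lia.
have [ki'|ik'] := leqP k i; first by rewrite Nup ?mul0r.
rewrite strict_upper_expr ?mulr0 //.
have : k != i.+1 :> nat by apply: contra ki => /eqP ki; apply/eqP/val_inj.
by move: ik' jim => /=; lia.
Qed.

(** An idempotent equals each of its positive powers, and one of these is 0. *)
Lemma strict_upper_idempotent : N * N = N -> N = 0.
Proof.
move=> NN; rewrite -strict_upper_nilpotent.
suff E m : N ^+ m.+1 = N by rewrite E.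
by elim: m => [|m IH]; rewrite ?expr1 // exprS IH NN.
Qed.

End StrictlyUpper.

Section CompleteSystem.
Variables (R : realType) (X : topologicalType) (K : comNzRingType) (n : nat).
Notation C n := (cochain R X K n).
Variable A : nat -> nat -> C 1.
Hypothesis dA : forall i j, (i <= j < n)%N ->
  cobound (A i j) = \sum_(i <= r < j) cup (A i r) (A r.+1 j).

(** [A i j] sits in column [j + 1]: the diagonal of the system becomes the superdiagonal, and the
    size is [n + 1]. *)
Definition system_mx (s : simplex R X 1) : 'M[K]_n.+1 :=
  \matrix_(i, j) if (i < j)%N then A i j.-1 s else 0.

Lemma system_mx_upper s (i j : 'I_n.+1) : (j <= i)%N -> system_mx s i j = 0.
Proof. by move=> ji; rewrite mxE ltnNge ji. Qed.

(** Read entrywise, [dA] says that the coboundary of the matrix is its cup square, which rearranges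
    to multiplicativity of [1 - N]. *)
Lemma system_mx_mul (s : simplex R X 2) :
  (1 - system_mx (edge s v0 v1)) * (1 - system_mx (edge s v1 v2)) =
  1 - system_mx (edge s v0 v2).
Proof.
suff E : system_mx (edge s v1 v2) - system_mx (edge s v0 v2) + system_mx (edge s v0 v1) =
    system_mx (edge s v0 v1) * system_mx (edge s v1 v2).
  rewrite mulrBl mul1r mulrBr mulr1 -E.
  by rewrite opprB addrK addrA subrK.
apply/matrixP => i j; rewrite !mxE.
have [ji|ij] := leqP j i.
  rewrite subr0 addr0 big1 // => k _; rewrite !mxE.
  by case: ifP; case: ifP; rewrite ?mul0r ?mulr0 //; lia.
have jn := ltn_ord j.
have ijn : (i <= j.-1 < n)%N by lia.
have := congr1 (fun c : C 2 => c s) (dA ijn).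
rewrite cobound1E cochain_sumE => ->.
rewrite (eq_bigr (fun r : nat => A i r (edge s v0 v1) * A r.+1 j.-1 (edge s v1 v2)));
  last by move=> r _; rewrite cup11E.
(* Reindex by [k = r + 1], the inner index of the matrix product; terms outside [i < k < j] vanish
   by triangularity. *)
rewrite -(big_add1 _ _ i j xpredT (fun k => A i k.-1 (edge s v0 v1) * A k j.-1 (edge s v1 v2))).
rewrite [RHS](eq_bigr (fun k : 'I_n.+1 => if (i < k < j)%N then
   A i k.-1 (edge s v0 v1) * A k j.-1 (edge s v1 v2) else 0)); last first.
  by move=> k _; rewrite !mxE; case: (i < k)%N; case: (k < j)%N; rewrite ?mul0r ?mulr0.
rewrite -big_mkcond /= (big_nat_widenl i.+1 0) //.
rewrite (@big_nat_widen _ _ _ 0 j n.+1) ?big_mkord; last exact: ltnW.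
by apply: eq_bigl => k.
Qed.

(** All edges of a constant triangle agree, so [1 - N], and with it [N], is idempotent; being
    nilpotent, [N] is 0. *)
Lemma system_mx_const (x : X) : 1 - system_mx (const_simplex R x 1) = 1.
Proof.
have := system_mx_mul (const_simplex R x 2).
have eE u v : edge (const_simplex R x 2) u v = const_simplex R x 1 by apply: simplexP.
rewrite !eE; set N := system_mx _ => E.
rewrite (@strict_upper_idempotent _ _ N) ?subr0 //; first exact: system_mx_upper.
move: E; rewrite mulrBl mul1r mulrBr mulr1 => /eqP.
by rewrite -subr_eq0 addrAC subrr add0r oppr_eq0 subr_eq0 => /eqP.
Qed.

End CompleteSystem.

(** * Values of degree-one classes on loops *)

Section LoopPeriods.
Variables (R : realType) (X : topologicalType) (x0 : X) (A : comNzRingType).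
Notation L := (loop R X x0).
Notation C n := (cochain R X A n).
Notation H n := (cohomology R X A n).

Lemma cobound0_loop (b : C 0) (l : L) : cobound b (loop_simplex l) = 0.
Proof.
rewrite cobound0E; apply/eqP; rewrite subr_eq0; apply/eqP; congr b.
have E (i : 'I_2) y : restr (fun=> i) (loop_simplex l) y = loop_simplex l (vertex R i).
  rewrite /restr /=; congr (l (clampI _)); congr (param _).
  apply: bcoord_inj => j; rewrite bcoord_push bcoord_vertex.
  by case: eqP => _; [exact: bcoord_sum|exact: big_pred0_eq].
by apply: simplexP => y; rewrite !E loop_simplex_vertex0 loop_simplex_vertex1.
Qed.

(** Two representatives differ by the coboundary of a 0-cochain, which vanishes on loops because
    their ends coincide. *)
Lemma represents_loop (c d : C 1) (h : H 1) (l : L) :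
  represents c h -> represents d h -> c (loop_simplex l) = d (loop_simplex l).
Proof.
move=> ch dh; have [b cb] := represents0P (represents_sub ch dh).
apply/eqP; rewrite -subr_eq0 -(cobound0_loop b l) -cb; exact/eqP.
Qed.

End LoopPeriods.

Section LoopPowers.
Variables (R : realType) (X : topologicalType) (x0 : X).
Notation L := (loop R X x0).

(** This is the power of exponent [k + 1]; the shift avoids a constant loop as unit. *)
Definition loop_power (l : L) k : L := iter k (concat l) l.

Lemma loop_power_mult (M : nzRingType) (U : simplex R X 1 -> M) (l : L) k :
  (forall s : simplex R X 2, U (edge s v0 v1) * U (edge s v1 v2) = U (edge s v0 v2)) ->
  U (loop_simplex (loop_power l k)) = U (loop_simplex l) ^+ k.+1.
Proof.
move=> UM; elim: k => [|k IH]; first by rewrite expr1.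
by rewrite [loop_power _ _]/= (concat_mult UM) IH -exprS.
Qed.

Lemma loop_power_add (G : zmodType) (f : pi1 R X x0 -> G) (l : L) k :
  {morph f : a b / pi1_mul a b >-> a + b} ->
  f (\pi_(pi1 R X x0) (loop_power l k)) = f (\pi_(pi1 R X x0) l) *+ k.+1.
Proof.
move=> fM; elim: k => [|k IH]; first by rewrite mulr1n.
by rewrite [loop_power _ _]/= pi1_mul_pi fM IH -mulrS.
Qed.

Lemma pi1_eqP (a b : L) : \pi_(pi1 R X x0) a = \pi_(pi1 R X x0) b <-> loop_homotopic a b.
Proof. by split=> [/eqmodP|ab]; [|apply/eqmodP]. Qed.

End LoopPowers.

(** * The Massey power of order [p] *)

Section MasseyPower.
Variables (R : realType) (p : nat) (X : topologicalType) (x0 : X).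
Hypothesis p_prime : prime p.
Notation L := (loop R X x0).

Lemma massey0_complete (T : cohomology R X 'F_p 1) :
  massey (nseq p T) 0 -> exists A : nat -> nat -> cochain R X 'F_p 1,
    (forall i, (i < p)%N -> represents (A i i) T) /\
    (forall i j, (i <= j < p)%N ->
      cobound (A i j) = \sum_(i <= r < j) cup (A i r) (A r.+1 j)).
Proof.
have p1 := prime_gt1 p_prime.
move=> [a []]; rewrite size_nseq => a1 a2 /represents0P[b bE].
have {}a1 i : (i < p)%N -> represents (a i i) T.
  by move=> ip; have := a1 i ip; rewrite nth_nseq ip.
(* The cochain [b] cobounding the product fills the corner, which no other entry or right-hand side
   involves; the corner is off the diagonal because [p > 1]. *)
pose A i j := if (i == 0%N) && (j == p.-1) then b else a i j.
have Aa i j : (i != 0%N) || (j != p.-1) -> A i j = a i j.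
  by rewrite /A -negb_and => /negPf ->.
exists A; split=> [i ip|i j /andP[ij jp]].
  by rewrite Aa; [exact: a1|lia].
rewrite (_ : \sum_(i <= r < j) _ = \sum_(i <= r < j) cup (a i r) (a r.+1 j)); last first.
  by apply: eq_big_nat => r /andP[ir rj]; rewrite !Aa //; lia.
have [/andP[/eqP i0 /eqP jE]|n0] := boolP ((i == 0%N) && (j == p.-1)).
  by rewrite /A i0 jE !eqxx /= -bE.
rewrite Aa -?negb_and //; move: ij; rewrite leq_eqVlt => /orP[/eqP ij|ij].
  by rewrite -ij big_geq //; apply: represents_cocycle (a1 i _); lia.
by apply: a2; rewrite ?ij // xpair_eqE.
Qed.

(** The homotopy hypothesis reads [l^(p+1) = l], that is [l^p = 1] stated without a unit. *)
Lemma massey0_loop (T : cohomology R X 'F_p 1) (t : cochain R X 'F_p 1) (l : L) :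
  massey (nseq p T) 0 -> represents t T -> loop_homotopic (loop_power l p) l ->
  t (loop_simplex l) = 0.
Proof.
move=> /massey0_complete[A [AT dA]] tT ll.
pose N := system_mx p A (loop_simplex l).
have Nup : forall i j : 'I_p.+1, (j <= i)%N -> N i j = 0 by exact: system_mx_upper.
have UM := system_mx_mul dA.
have U1 := system_mx_const dA x0.
pose U s : 'M['F_p]_p.+1 := 1 - system_mx p A s.
have := @homotopic_mult _ _ _ _ U UM U1 _ _ ll.
rewrite (@loop_power_mult _ _ _ _ U) // exprSr -[U _]/(1 - N).
have pM : p \in [pchar 'M['F_p]_p.+1] by rewrite pchar_lalg pchar_Fp.
have -> : (1 - N) ^+ p = 1 - N ^+ p.
  rewrite -(pFrobenius_autE pM) pFrobenius_autB_comm; last exact: commr_sym (commr1 _).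
  by rewrite !pFrobenius_autE expr1n.
(* In [(1 - N^p) (1 - N) = 1 - N] the term [N^(p+1)] vanishes since [N] has size [p + 1], leaving
   [N^p = 0]. *)
rewrite mulrBl mul1r mulrBr mulr1 -exprSr (strict_upper_nilpotent Nup) subr0.
move=> /eqP; rewrite -subr_eq0 addrAC subrr add0r oppr_eq0 => /eqP Np0.
have Nt (i j : 'I_p.+1) : j = i.+1 :> nat -> N i j = t (loop_simplex l).
  move=> ji; rewrite mxE ji ltnSn /=.
  by apply: represents_loop (AT i _) tT; have := ltn_ord j; rewrite ji ltnS.
have := strict_upper_corner Nup Nt; rewrite Np0 mxE => /esym/eqP.
by rewrite expf_eq0 => /andP[_ /eqP].
Qed.

End MasseyPower.

Theorem corollary1p12 (R : realType) (p : nat) (p_prime : prime p)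
    (X : topologicalType) (x0 : X) (X_connected : connected [set: X])
    (pi1_iso : exists f : pi1 R X x0 -> 'Z_p,
       bijective f /\ {morph f : a b / pi1_mul a b >-> a + b})
    (T : cohomology R X 'F_p 1)
    (T_generator : forall h : cohomology R X 'F_p 1, exists n : nat, h = T *+ n) :
  (forall k, (2 <= k <= p.-1)%N -> massey_vanishes (nseq k T)) /\
  massey_nonzero (nseq p T).
Proof.
have p1 := prime_gt1 p_prime.
split=> [k kp|]; first by apply: massey_power_vanishes => //; lia.
have [t tT] := represents_exists T.
split; first by eexists; exact: (dpcochain_defining_system p_prime tT (leqnn p)).
move=> m0; have [f [[f' fK f'K] fM]] := pi1_iso.
(* ['F_p] is ['Z_(pdiv p)], so the residue has to pass through [nat]. *)
pose phi (l : loop R X x0) : 'F_p := (f (\pi_(pi1 R X x0) l) : nat)%:R.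
have phi_h (a b : loop R X x0) : loop_homotopic a b -> phi a = phi b.
  by move=> /pi1_eqP ab; rewrite /phi ab.
have phi_c (a b : loop R X x0) : phi (concat a b) = phi a + phi b.
  have modE n : (n %% (Zp_trunc p).+2 = n %% p)%N by rewrite Zp_cast.
  by rewrite /phi pi1_mul_pi fM /= modE Fp_nat_mod // natrD.
have [c [c0 cE]] := cocycle_of_pi1_morphism phi_h phi_c.
have [h ch] := represents_of_cocycle c0; have [n hT] := T_generator h.
pose l := repr (f' 1).
have fl : f (\pi_(pi1 R X x0) l) = 1 by rewrite reprK f'K.
have ll : loop_homotopic (loop_power l p) l.
  apply/pi1_eqP/(can_inj fK); rewrite (loop_power_add _ _ fM) fl.
  by rewrite mulrS pchar_Zp // addr0.
have tl := massey0_loop p_prime m0 tT ll.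
(* The class of [c] is a multiple of [T], so [c] vanishes on [l] along with [t]; yet [c] takes the
   value [phi l = 1] there. *)
rewrite hT in ch; have := represents_loop l ch (representsMn n tT).
rewrite cE /phi fl.
have -> : (t *+ n) (loop_simplex l) = t (loop_simplex l) *+ n.
  by elim: n {hT ch} => // n IH; rewrite !mulrS -IH.
by rewrite tl mul0rn /= modn_small // => /eqP; rewrite oner_eq0.
Qed.
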